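(* Let $m$ be a positive integer, $n=3m$, and let $\delta\in\mathbb{F}_{2^n}$ satisfy ${\rm Tr}_m^{3m}(\delta)=0$. Let $F(X)=(X^{2^m}+X+\delta)^{2^{2m+1}+2^m}+(X^{2^m}+X+\delta)^{2^{2m}+2^{m+1}}+X$, viewed as a function $\mathbb{F}_{2^n}\to\mathbb{F}_{2^n}$. Then $F$ is P$c$N for every $c\in\mathbb{F}_{2^m}\setminus\{1\}$.
   Context: ${\rm Tr}_m^{3m}(X)=X+X^{2^m}+X^{2^{2m}}$ is the relative trace from $\mathbb{F}_{2^{3m}}$ to $\mathbb{F}_{2^m}$. For $F:\mathbb{F}_q\to\mathbb{F}_q$ and $a,b,c\in\mathbb{F}_q$, let ${}_c\Delta_F(a,b)$ be the number of $X\in\mathbb{F}_q$ with $F(X+a)-cF(X)=b$. The $c$-differential uniformity of $F$ is ${}_c\Delta_F=\max\{{}_c\Delta_F(a,b): a,b\in\mathbb{F}_q,\ a\neq 0 \text{ if } c=1\}$. $F$ is perfect $c$-nonlinear (P$c$N) if ${}_c\Delta_F=1$. *)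

(* Defs.v *)
From HB Require Import structures.
From mathcomp Require Import all_boot all_order all_algebra all_fingroup all_field.

Set Implicit Arguments.
Unset Strict Implicit.
Unset Printing Implicit Defensive.

Import GRing.Theory.
Local Open Scope ring_scope.

(* The relative trace from the field of order 2^(3m) to its subfield of order
   2^m, with values seen in the big field. *)
Definition relTr (L : finFieldType) (m : nat) (x : L) : L :=
  x + x ^+ (2 ^ m)%N + x ^+ (2 ^ (2 * m))%N.

Definition cDelta_at (L : finFieldType) (c : L) (F : L -> L) (a b : L) : nat :=
  #|[set x : L | F (x + a) - c * F x == b]|.

Definition cDelta (L : finFieldType) (c : L) (F : L -> L) : nat :=
  \max_(ab : L * L | (c == 1) ==> (ab.1 != 0)) cDelta_at c F ab.1 ab.2.

Definition PcN (L : finFieldType) (c : L) (F : L -> L) : Prop :=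
  cDelta c F = 1%N.

Definition Fpoly (L : finFieldType) (m : nat) (delta : L) (x : L) : L :=
  (x ^+ (2 ^ m)%N + x + delta) ^+ (2 ^ (2 * m + 1) + 2 ^ m)%N
  + (x ^+ (2 ^ m)%N + x + delta) ^+ (2 ^ (2 * m) + 2 ^ (m + 1))%N
  + x.

(* Main.v *)
Require Import Defs.
From HB Require Import structures.
From mathcomp Require Import all_boot all_order all_algebra all_fingroup all_field.
From mathcomp Require Import ring.

Import GRing.Theory.
Local Open Scope ring_scope.

(** Put [q = 2 ^ m] and [y = x ^ q + x + delta].  Since [y] has relative trace 0,
    the nonlinear part of [F x] is the relative norm of [y], so it lies in the
    field of order [q].  If [x] and [x'] give the same value of
    [F (x + a) - c * F x], then [(1 - c) * (x - x')] lies in that field, and so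
    does [x - x'] as [c != 1].  Then [x] and [x'] give the same [y], the norm
    terms cancel, and [x = x']. *)

Definition normPart {L : finFieldType} (m : nat) (y : L) : L :=
  y ^+ (2 ^ (2 * m + 1) + 2 ^ m)%N + y ^+ (2 ^ (2 * m) + 2 ^ (m + 1))%N.

Lemma exprD_pchar2 {R : comNzRingType} (m : nat) (x y : R) :
  2%N \in [pchar R] -> (x + y) ^+ (2 ^ m)%N = x ^+ (2 ^ m)%N + y ^+ (2 ^ m)%N.
Proof. by move=> char2; rewrite exprDn_pchar // pnatX pnatE // char2. Qed.

(** With [v] and [w] the conjugates of [y], trace 0 in characteristic 2 means [y = v + w]. Then
    [normPart m y] factors as [v * w * (v + w) = y * v * w], and the [q]-power map permutes the
    three factors cyclically. *)
Lemma normPart_fixed (L : finFieldType) (m : nat) (y : L) :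
  #|L| = (2 ^ (3 * m))%N -> 2%N \in [pchar L] -> relTr m y = 0 ->
  normPart m y ^+ (2 ^ m)%N = normPart m y.
Proof.
move=> cardL char2 tr0; have twoE : 2%:R = 0 :> L := pcharf0 char2.
set q := (2 ^ m)%N; set v := y ^+ q; set w := v ^+ q.
have wE : y ^+ (2 ^ (2 * m))%N = w by rewrite mul2n -addnn expnD exprM.
have wq : w ^+ q = y.
  rewrite -[RHS]expf_card cardL -wE -exprM -expnD.
  by congr (_ ^+ (2 ^ _)); ring.
have yE : y = v + w.
  move: tr0; rewrite /relTr wE -/q -/v -addrA => /eqP.
  by rewrite addr_eq0 oppr_pchar2 // => /eqP.
have -> : normPart m y = w ^+ 2 * v + w * v ^+ 2.
  by rewrite /normPart !exprD !addn1 !expnSr !exprM wE.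
rewrite exprD_pchar2 // !exprMn -/q wq -/w yE.
(* [ring] does not know the characteristic, so the even surplus is split off by hand. *)
transitivity (w ^+ 2 * v + w * v ^+ 2 + 2%:R * (v * w ^+ 2 + w ^+ 3)); first by ring.
by rewrite twoE mul0r addr0.
Qed.

(** Since [x ^+ (q ^ 3) = x], the elements [x ^+ q] and [x] have the same trace, and the two cancel
    in characteristic 2. *)
Lemma relTr_artin_schreier (L : finFieldType) (m : nat) (x delta : L) :
  #|L| = (2 ^ (3 * m))%N -> 2%N \in [pchar L] -> relTr m delta = 0 ->
  relTr m (x ^+ (2 ^ m)%N + x + delta) = 0.
Proof.
move=> cardL char2; rewrite /relTr !exprD_pchar2 // -!exprM -!expnD.
have twoE : 2%:R = 0 :> L := pcharf0 char2.
have -> : (m + 2 * m = 3 * m)%N by rewrite -mulSn.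
rewrite -cardL expf_card addnn -mul2n => tr0.
transitivity (relTr m delta + 2%:R * (x ^+ (2 ^ (2 * m))%N + x ^+ (2 ^ m)%N + x)).
  by rewrite /relTr; ring.
by rewrite [relTr _ _]tr0 twoE mul0r addr0.
Qed.

Lemma PcN_of_injective (L : finFieldType) (c : L) (F : L -> L) :
  c != 1 -> (forall a, injective (fun x => F (x + a) - c * F x)) -> PcN c F.
Proof.
move=> c1 injF; apply/eqP; rewrite eqn_leq; apply/andP; split.
  apply/bigmax_leqP => -[a b] _; apply/card_le1_eqP => x x' /=.
  by rewrite !inE => /eqP xb /eqP x'b; apply: (injF a); rewrite /= xb x'b.
have c1F : (c == 1) = false by apply: negbTE.
(* The shift 0 is admissible because [c != 1], and 0 lies in the chosen fibre. *)
apply: leq_trans (leq_bigmax_cond (0, F (0 + 0) - c * F 0) _); last by rewrite c1F.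
by apply/card_gt0P; exists 0; rewrite inE.
Qed.

Theorem theorem3p4 (m n : nat) (hm : (0 < m)%N) (hn : n = (3 * m)%N)
  (K L : finFieldType) (hK : #|K| = (2 ^ m)%N) (hL : #|L| = (2 ^ n)%N)
  (iota : {rmorphism K -> L}) (delta : L) (hdelta : relTr m delta = 0) :
  forall c : K, c != 1 -> PcN (iota c) (Fpoly m delta).
Proof.
move=> c c1; rewrite {n}hn in hL.
have char2 : 2%N \in [pchar L] by apply: card_finPcharP hL _.
have d1 : 1 - iota c != 0 by rewrite subr_eq0 eq_sym fmorph_eq1.
apply: PcN_of_injective => [|a x x' /= eqF]; first by rewrite fmorph_eq1.
pose y z := z ^+ (2 ^ m)%N + z + delta.
pose N z := normPart m (y z).
have FE z : Fpoly m delta z = N z + z by [].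
have Nq z : N z ^+ (2 ^ m)%N = N z.
  by apply: normPart_fixed => //; apply: relTr_artin_schreier.
have Ny z z' : y z = y z' -> N z = N z' by rewrite /N => ->.
(* From here on [N] is known only through [FE], [Nq] and [Ny]. *)
clearbody N.
have cq : iota c ^+ (2 ^ m)%N = iota c by rewrite -rmorphXn -hK expf_card.
have subq := fun u v : L => exprD_pchar2 m u v char2.
have oppE (u : L) : - u = u by rewrite oppr_pchar2.
have diffE : (1 - iota c) * (x - x') =
    N (x' + a) - N (x + a) - iota c * (N x' - N x).
  apply/eqP; rewrite -subr_eq0; apply/eqP.
  by move/eqP: eqF; rewrite -subr_eq0 !FE => /eqP <-; ring.
have diffq : (x - x') ^+ (2 ^ m)%N = x - x'.
  (* The nonzero factor [1 - iota c] is itself fixed by the [q]-power map, so it can be cancelled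
     from the fixed product in [diffE]. *)
  apply: (mulfI d1); rewrite [RHS]diffE.
  have {1}-> : 1 - iota c = (1 - iota c) ^+ (2 ^ m)%N.
    by rewrite !oppE subq expr1n cq.
  by rewrite -exprMn diffE !oppE !(subq, exprMn) !Nq cq.
(* Needed at [u = a] and [u = 0]: the difference of the two sides is [(x - x') ^+ q + (x - x')],
   which is twice [x - x']. *)
have yE u : y (x + u) = y (x' + u).
  apply/eqP; rewrite -subr_eq0 /y !subq; apply/eqP.
  transitivity ((x ^+ (2 ^ m)%N - x' ^+ (2 ^ m)%N) + (x - x')); first by ring.
  have <- : (x - x') ^+ (2 ^ m)%N = x ^+ (2 ^ m)%N - x' ^+ (2 ^ m)%N.
    by rewrite !oppE subq.
  by rewrite diffq addrr_pchar2.
have NE u : N (x + u) = N (x' + u) by apply: Ny.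
have := NE 0; rewrite !addr0 => N0.
move/eqP: diffE; rewrite NE N0 !subrr mulr0 subr0 mulf_eq0 (negbTE d1) /=.
by rewrite subr_eq0 => /eqP.
Qed.
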